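(* Let $n\ge 1$ and let $S$ be any position reachable in the qubit game from the chain of $n$ vertices all coloured white. Let $p(S)$ be the probability, under optimal play by both players, that the player about to move in $S$ loses. Then: $$\begin{aligned} &\text{if } S \text{ has type } (0,W), && 0\le p(S)<\tfrac13;\\ &\text{if } S \text{ has type } (1,W), && \tfrac13< p(S)\le \tfrac12;\\ &\text{if } S \text{ has type } (0,L), && \tfrac23< p(S)\le 1;\\ &\text{if } S \text{ has type } (1,L), && \tfrac12\le p(S)<\tfrac23 . \end{aligned}$$
   Context: **Qubit game.** A position is a finite graph whose vertices are coloured white, light grey, black or dark grey (''grey'' means light grey or dark grey). Two players alternate. The player to move chooses a vertex $v$. If $v$ is black, that player loses and the game stops. If $v$ is grey, that player loses (and the game stops) with probability $1/2$, independently of everything else; with probability $1/2$ the game continues. If $v$ is white, the game continues. When the game continues, $v$ is deleted from the graph and the colour of each of its neighbours is changed by the rule white $\to$ light grey $\to$ black $\to$ dark grey $\to$ white; then it is the other player's turn. A player who must move when no vertex remains loses. Here the starting graph is a chain (path), so every position reached is a disjoint union of coloured paths. A position is reachable if it can arise, with the game not yet stopped, after finitely many moves (possibly none) from the starting position. **Losing probability.** Each player chooses vertices so as to minimise their own probability of losing; $p(S)$ is the resulting losing probability of the player to move in $S$. Thus $p(S)=1$ if $S$ has no vertex, and otherwise $p(S)$ is the minimum over vertices $v$ of: $1$ if $v$ is black; $1-p(S_v)$ if $v$ is white; $\frac12+\frac12(1-p(S_v))$ if $v$ is grey, where $S_v$ is the position obtained by deleting $v$ and recolouring its neighbours. **White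 game.** On an uncoloured graph, two players alternately choose a vertex and delete it together with all its neighbours; the first player who cannot move loses. The white game associated with $S$ is the white game played on the subgraph induced by the white vertices of $S$. **Lucky play.** A complete lucky play from $S$ is a maximal sequence of moves in which only white or grey vertices are chosen and every chosen grey vertex lets the game continue (no loss occurs); it ends when no white or grey vertex remains. **Type.** The type of $S$ is a pair $(\epsilon,X)$. Here $\epsilon=0$ (resp. $\epsilon=1$) if in every complete lucky play from $S$ the number of vertices that are grey at the moment they are chosen is even (resp. odd). And $X=W$ if the player to move has a winning strategy in the white game associated with $S$, and $X=L$ otherwise. *)

(* Defs.v *)
From HB Require Import structures.
From mathcomp Require Import all_boot all_order all_algebra.
Set Implicit Arguments.
Unset Strict Implicit.
Unset Printing Implicit Defensive.
Import Order.TTheory GRing.Theory Num.Theory.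
Local Open Scope ring_scope.

Inductive colour := White | LightGrey | Black | DarkGrey.

Definition next_colour (c : colour) : colour :=
  match c with
  | White => LightGrey
  | LightGrey => Black
  | Black => DarkGrey
  | DarkGrey => White
  end.

(* A position on the graph (T, e) maps each remaining vertex v to [Some c],
   with c its colour, and each deleted vertex to [None]; the graph of the
   position is the one induced by e on the remaining vertices. *)
Definition position (T : finType) := {ffun T -> option colour}.

Definition is_white (oc : option colour) : bool :=
  if oc is Some White then true else false.

Definition is_grey (oc : option colour) : bool :=
  match oc with Some LightGrey | Some DarkGrey => true | _ => false end.

Definition vertices (T : finType) (S : position T) : {set T} :=
  [set v | isSome (S v)].

Definition delete (T : finType) (e : rel T) (S : position T) (v : T) :
    position T :=
  [ffun w => if w == v then None
             else if e v w then omap next_colour (S w) else S w].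

(* Exactly the white and grey vertices can be chosen without the game
   necessarily stopping. *)
Definition survivable (T : finType) (S : position T) (v : T) : bool :=
  is_white (S v) || is_grey (S v).

Inductive reachable (T : finType) (e : rel T) (S0 : position T) :
    position T -> Prop :=
| reachable_refl : reachable e S0 S0
| reachable_move (S : position T) (v : T) :
    reachable e S0 S -> survivable S v -> reachable e S0 (delete e S v).

(* [k] is fuel: each move deletes one vertex, so [#|vertices S|] suffices.
   All the values minimised over are at most 1, so using 1 as the default
   value of the minimum only matters when no vertex remains, in which case the
   player to move loses; see [lose_probE]. *)
Fixpoint lose_prob_rec (R : realFieldType) (T : finType) (e : rel T)
    (k : nat) (S : position T) : R :=
  if k is k'.+1 then
    \big[Num.min/1]_(v in vertices S)
      match S v with
      | Some White => 1 - lose_prob_rec R e k' (delete e S v)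
      | Some LightGrey | Some DarkGrey =>
          1 / 2 + 1 / 2 * (1 - lose_prob_rec R e k' (delete e S v))
      | Some Black | None => 1
      end
  else 1.

Definition lose_prob (R : realFieldType) (T : finType) (e : rel T)
    (S : position T) : R :=
  lose_prob_rec R e #|vertices S| S.

Lemma card_vertices_delete (T : finType) (e : rel T) (S : position T) (v : T) :
  v \in vertices S -> #|vertices S| = #|vertices (delete e S v)|.+1.
Proof.
move=> vS; rewrite (cardsD1 v) vS; congr _.+1; apply: eq_card => w.
by rewrite !inE ffunE; case: eqP => //= _; case: (e v w); case: (S w).
Qed.

Lemma lose_probE (R : realFieldType) (T : finType) (e : rel T)
    (S : position T) :
  lose_prob R e S =
    \big[Num.min/1]_(v in vertices S)
      match S v with
      | Some White => 1 - lose_prob R e (delete e S v)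
      | Some LightGrey | Some DarkGrey =>
          1 / 2 + 1 / 2 * (1 - lose_prob R e (delete e S v))
      | Some Black | None => 1
      end.
Proof.
rewrite {1}/lose_prob; case Dk: #|_| => [|k] /=.
  by rewrite big_pred0 // => v; rewrite (cards0_eq Dk) inE.
apply: eq_bigr => v vS; rewrite /lose_prob.
by move: Dk; rewrite (card_vertices_delete e vS) => -[->].
Qed.

(* The white game on the subgraph of (T, e) induced by A. *)
Definition delete_closed_nbhd (T : finType) (e : rel T) (A : {set T}) (v : T) :
    {set T} :=
  [set w in A | (w != v) && ~~ e v w].

(* [wins_with e sigma A]: the player to move on A, who chooses [sigma B]
   whenever it is their turn on B, always has a legal move and wins against
   every play of the opponent. *)
Inductive wins_with (T : finType) (e : rel T) (sigma : {set T} -> T) :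
    {set T} -> Prop :=
| WinsWith (A : {set T}) :
    sigma A \in A ->
    (forall w : T, w \in delete_closed_nbhd e A (sigma A) ->
       wins_with e sigma
         (delete_closed_nbhd e (delete_closed_nbhd e A (sigma A)) w)) ->
    wins_with e sigma A.

Definition white_game_win (T : finType) (e : rel T) (A : {set T}) : Prop :=
  exists sigma : {set T} -> T, wins_with e sigma A.

Definition white_vertices (T : finType) (S : position T) : {set T} :=
  [set v | is_white (S v)].

(* A play is given by the sequence of the vertices successively chosen. *)
Fixpoint complete_lucky_play (T : finType) (e : rel T) (S : position T)
    (s : seq T) : bool :=
  if s is v :: s' then
    survivable S v && complete_lucky_play e (delete e S v) s'
  else [forall v, ~~ survivable S v].

Fixpoint grey_choices (T : finType) (e : rel T) (S : position T)
    (s : seq T) : nat :=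
  if s is v :: s' then
    (is_grey (S v) + grey_choices e (delete e S v) s')%N
  else 0%N.

Inductive outcome := W | L.

Definition has_type (T : finType) (e : rel T) (S : position T)
    (t : nat * outcome) : Prop :=
  (forall s : seq T, complete_lucky_play e S s ->
     (grey_choices e S s %% 2)%N = t.1) /\
  match t.2 with
  | W => white_game_win e (white_vertices S)
  | L => ~ white_game_win e (white_vertices S)
  end.

Definition chain_adj (n : nat) : rel 'I_n :=
  fun i j => (i.+1 == j :> nat) || (j.+1 == i :> nat).

Definition white_chain (n : nat) : position 'I_n := [ffun => Some White].

(* Main.v *)
Require Import Defs.
From HB Require Import structures.
From mathcomp Require Import all_boot all_order all_algebra.
From mathcomp Require Import zify lra.
Set Implicit Arguments.
Unset Strict Implicit.
Unset Printing Implicit Defensive.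
Import Order.TTheory GRing.Theory Num.Theory.
Local Open Scope ring_scope.

(** In a chain a vertex sees at most two deletions before being chosen, so
    dark grey never occurs, no deletion creates a white vertex, and a move on a
    white vertex is exactly a move of the white game.  A grey move flips the
    parity epsilon and a white move keeps it, so the intervals propagate by
    induction on the number of remaining vertices.  The only delicate bound is
    p < 2/3 for the type (1, L): any white move leads to a (1, W) position,
    which has p > 1/3; if no vertex is white, there is a grey vertex (otherwise
    the empty play would have even parity), and choosing it leads to a (0, L)
    position, which has p > 2/3. *)

(** * Deciding the white game by backward induction *)

Section WhiteGame.

Variables (T : finType) (e : rel T).
Implicit Types (A : {set T}) (v : T).

(** A boolean counterpart of [white_game_win], so that outcomes can be compared and case-split; [k]
    is fuel, one unit per move. *)
Fixpoint white_win_rec k A : bool :=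
  if k is k'.+1
  then [exists v in A, ~~ white_win_rec k' (delete_closed_nbhd e A v)]
  else false.

Definition white_win A : bool := white_win_rec #|A| A.

Lemma card_delete_closed_nbhd A v :
  v \in A -> (#|delete_closed_nbhd e A v| < #|A|)%N.
Proof.
move=> vA; apply: proper_card; apply/properP; split.
  by apply/subsetP=> w; rewrite inE => /andP[].
by exists v; rewrite // inE eqxx andbF.
Qed.

Lemma white_win_rec_fuel k A :
  (#|A| <= k)%N -> white_win_rec k A = white_win A.
Proof.
rewrite /white_win; move Dm: #|A| => m.
elim/ltn_ind: m k A Dm => m IHm [|k] A Dm lemk.
  by move: lemk; rewrite leqn0 => /eqP->.
case: m Dm IHm lemk => [|m] Dm IHm lemk.
  rewrite /=; apply/existsP=> -[v].
  by move/eqP: Dm; rewrite cards_eq0 => /eqP->; rewrite inE.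
rewrite /=; apply: eq_existsb => v; case vA: (v \in A) => //=; congr (~~ _).
have ltm : (#|delete_closed_nbhd e A v| <= m)%N.
  by have := card_delete_closed_nbhd vA; rewrite Dm.
by rewrite (IHm _ _ k _ erefl) ?(IHm _ _ m _ erefl) // (leq_trans ltm).
Qed.

Lemma white_winE A :
  white_win A = [exists v in A, ~~ white_win (delete_closed_nbhd e A v)].
Proof.
rewrite -(white_win_rec_fuel (leqnSn #|A|)) /=.
apply: eq_existsb => v; case vA: (v \in A) => //=.
by rewrite white_win_rec_fuel // ltnW // card_delete_closed_nbhd.
Qed.

(** A single strategy for all winning sets is to pick a move to a losing set; the converse is
    induction on [wins_with]. *)
Lemma white_winP A : reflect (white_game_win e A) (white_win A).
Proof.
apply: (iffP idP) => [winA | [sigma]]; last first.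
  elim=> {}A sA _ IH; rewrite white_winE; apply/existsP; exists (sigma A).
  rewrite sA /= white_winE; apply/existsP=> -[w /andP[wB]].
  by rewrite (IH w wB).
(* [v0] only makes [sigma] total: it is its value on sets without a winning move. *)
have [v0 _ _] := exists_inP (etrans (esym (white_winE A)) winA).
have [sigma sigmaP] : exists sigma : {set T} -> T, forall B, white_win B ->
    (sigma B \in B) && ~~ white_win (delete_closed_nbhd e B (sigma B)).
  exists (fun B : {set T} => odflt v0
    [pick v in B | ~~ white_win (delete_closed_nbhd e B v)]) => B.
  rewrite white_winE; case: pickP => //= noMove /existsP[v].
  by rewrite noMove.
exists sigma; have [m] := ubnP #|A|.
elim: m A winA => [|m IHm] A winA leAm; first by rewrite ltn0 in leAm.
have /andP[sA loseA] := sigmaP A winA.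
apply: WinsWith => [|w wB]; first exact: sA.
have ltA := card_delete_closed_nbhd sA.
have ltB := card_delete_closed_nbhd wB.
apply: IHm; last by rewrite -ltnS (leq_trans _ leAm) // ltnS (leq_trans ltB) // ltnW.
apply: contraR loseA => loseB.
by rewrite white_winE; apply/existsP; exists w; rewrite wB.
Qed.

End WhiteGame.

(** * Colours in reachable positions *)

Section Reachable.

Variables (T : finType) (e : rel T).
Implicit Type S : position T.

(** Each deletion of a neighbour advances the colour once, so the colour counts the deleted
    neighbours. *)
Lemma reachable_colour S w c :
  reachable e [ffun => Some White] S -> S w = Some c ->
  c = iter #|[set v | e v w & ~~ S v]| next_colour White.
Proof.
move=> reachS; elim: reachS w c => [w c | {}S v _ IH aliveS w c].
  rewrite ffunE => -[<-]; rewrite (_ : [set v | _ & _] = set0) ?cards0 //.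
  by apply/setP=> v; rewrite !inE ffunE andbF.
have vS : S v.
  by move: aliveS; rewrite /survivable; case: (S v).
rewrite ffunE; case: eqP => // _.
have [evw | nevw] := ifPn.
  case Sw: (S w) => [c'|] //= -[<-]; rewrite (IH _ _ Sw) -iterS.
  (* The only new deleted neighbour is [v], which [vS] shows was still present in [S]. *)
  congr (iter _ next_colour White); rewrite (cardsD1 v [set u | e u w & ~~ delete e S v u]).
  rewrite inE evw ffunE eqxx add1n; congr _.+1; apply: eq_card => u.
  rewrite !inE ffunE; have [-> | _] /= := eqVneq u v.
    by rewrite vS andbF.
  by case: (e v u); case: (S u).
move=> Sw; rewrite (IH _ _ Sw); congr (iter _ next_colour White); apply: eq_card => u.
rewrite !inE ffunE; have [-> | _] /= := eqVneq u v; first by rewrite (negPf nevw).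
by case: (e v u); case: (S u).
Qed.

Lemma reachable_not_dark S w :
  (forall u, #|[set v | e v u]| <= 2)%N ->
  reachable e [ffun => Some White] S -> S w <> Some DarkGrey.
Proof.
move=> deg2 reachS /(reachable_colour reachS).
have : (#|[set v | e v w & ~~ S v]| <= 2)%N.
  apply: leq_trans (deg2 w); apply: subset_leq_card.
  by apply/subsetP=> v; rewrite !inE => /andP[].
by case: #|_| => [|[|[|m]]].
Qed.

(** Only dark grey turns white, so no white vertex appears, and the white neighbours of [v] are
    lost. This holds for grey [v] as well. *)
Lemma white_vertices_delete S v :
  (forall w, S w <> Some DarkGrey) ->
  white_vertices (delete e S v) = delete_closed_nbhd e (white_vertices S) v.
Proof.
move=> noDark; apply/setP=> w; rewrite !inE ffunE.
have [-> | _] := eqVneq w v; first by rewrite andbF.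
have := noDark w.
by case: (e v w); case: (S w) => [[]|] //=; rewrite ?andbF ?andbT.
Qed.

End Reachable.

(** * Propagation of the probability intervals *)

Section LosingProbability.

Variables (R : realFieldType) (T : finType) (e : rel T).
Implicit Types (S : position T) (v : T) (b : bool).

(** The grey value is 1/2 + (1 - p)/2, simplified to 1 - p/2. *)
Definition move_risk S v : R :=
  if is_white (S v) then 1 - lose_prob R e (delete e S v)
  else if is_grey (S v) then 1 - lose_prob R e (delete e S v) / 2
  else 1.

Lemma lose_prob_min S :
  lose_prob R e S = \big[Num.min/1]_(v in vertices S) move_risk S v.
Proof.
rewrite lose_probE; apply: eq_bigr => v _; rewrite /move_risk.
by case: (S v) => [[]|] //=; lra.
Qed.

Lemma survivable_vertex S v : survivable S v -> v \in vertices S.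
Proof. by rewrite inE /survivable; case: (S v). Qed.

Lemma lose_prob_le_move S v :
  survivable S v -> lose_prob R e S <= move_risk S v.
Proof.
move=> aliveS; rewrite lose_prob_min.
exact/bigmin_le_cond/survivable_vertex.
Qed.

(** The condition [x < 1] accounts for the default value 1 of the minimum. *)
Lemma lose_prob_gt S (x : R) :
  x < 1 -> (forall v, v \in vertices S -> x < move_risk S v) ->
  x < lose_prob R e S.
Proof. by move=> x1 riskS; rewrite lose_prob_min; apply/bigmin_gtP. Qed.

Lemma lose_prob_ge S (x : R) :
  x <= 1 -> (forall v, v \in vertices S -> x <= move_risk S v) ->
  x <= lose_prob R e S.
Proof. by move=> x1 riskS; rewrite lose_prob_min; apply/bigmin_geP. Qed.

Lemma lose_prob_le1 S : lose_prob R e S <= 1.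
Proof. by rewrite lose_prob_min bigmin_le_id. Qed.

Lemma lose_prob_ge0 S : 0 <= lose_prob R e S.
Proof.
apply: lose_prob_ge => // v _; rewrite /move_risk.
have := lose_prob_le1 (delete e S v).
by case: ifP => _; [|case: ifP => _]; lra.
Qed.

Definition lucky_parity S b : Prop :=
  forall s, complete_lucky_play e S s -> odd (grey_choices e S s) = b.

(** Prefixing [v] to a complete lucky play of the new position gives one of [S]. *)
Lemma lucky_parity_delete S v b :
  lucky_parity S b -> survivable S v ->
  lucky_parity (delete e S v) (b (+) is_grey (S v)).
Proof.
move=> parS aliveS s playS.
have := parS (v :: s); rewrite /= aliveS playS => /(_ isT) <-.
by rewrite oddD oddb addbC addKb.
Qed.

Definition type_range b (win : bool) (p : R) : bool :=
  match b, win with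
  | false, true => 0 <= p < 1 / 3
  | true, true => 1 / 3 < p <= 1 / 2
  | false, false => 2 / 3 < p <= 1
  | true, false => 1 / 2 <= p < 2 / 3
  end.

Lemma lose_prob_type_range S b :
  (forall u, #|[set v | e v u]| <= 2)%N ->
  reachable e [ffun => Some White] S -> lucky_parity S b ->
  type_range b (white_win e (white_vertices S)) (lose_prob R e S).
Proof.
move=> deg2; have [m] := ubnP #|vertices S|.
elim: m S b => // m IHm S b ltSm reachS parS.
have noDark w := reachable_not_dark (w := w) deg2 reachS.
have IH v : survivable S v ->
    type_range (b (+) is_grey (S v))
      (white_win e (delete_closed_nbhd e (white_vertices S) v))
      (lose_prob R e (delete e S v)).
  move=> aliveS; rewrite -white_vertices_delete //; apply: IHm.
  - have := survivable_vertex aliveS.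
    by move=> /(card_vertices_delete e) cardS; rewrite -ltnS -cardS.
  - exact: reachable_move.
  - exact: lucky_parity_delete.
have whiteP v : v \in white_vertices S ->
    [/\ survivable S v, move_risk S v = 1 - lose_prob R e (delete e S v)
      & type_range b (white_win e (delete_closed_nbhd e (white_vertices S) v))
          (lose_prob R e (delete e S v))].
  rewrite inE => Sv; have aliveS : survivable S v by rewrite /survivable Sv.
  split=> //; first by rewrite /move_risk Sv.
  by have := IH v aliveS; case: (S v) Sv => [[]|] //; rewrite addbF.
have greyP v : is_grey (S v) ->
    [/\ survivable S v, move_risk S v = 1 - lose_prob R e (delete e S v) / 2
      & type_range (~~ b)
          (white_win e (delete_closed_nbhd e (white_vertices S) v))
          (lose_prob R e (delete e S v))].
  move=> Sv; have aliveS : survivable S v by rewrite /survivable Sv orbT.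
  split=> //; first by rewrite /move_risk Sv; case: (S v) Sv => [[]|].
  by have := IH v aliveS; rewrite Sv addbT.
(* Black and deleted vertices have risk 1, which leaves only white and grey moves to bound. *)
have riskP (Q : R -> Prop) : Q 1 ->
    (forall v, v \in white_vertices S -> Q (move_risk S v)) ->
    (forall v, is_grey (S v) -> Q (move_risk S v)) ->
    forall v, Q (move_risk S v).
  move=> Q1 Qwhite Qgrey v.
  case Sv: (S v) => [[]|]; try by rewrite /move_risk Sv.
  - by apply: Qwhite; rewrite inE Sv.
  - by apply: Qgrey; rewrite Sv.
  - by apply: Qgrey; rewrite Sv.
have grey_half v : is_grey (S v) -> 1 / 2 <= move_risk S v.
  by case/greyP=> _ -> _; have := lose_prob_le1 (delete e S v); lra.
have ge0 := lose_prob_ge0 S; have le1 := lose_prob_le1 S.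
have [winS | loseS] := boolP (white_win e (white_vertices S)).
  (* A winning white move keeps the parity and reaches p > 2/3 (even) or p >= 1/2 (odd), whence both
     upper bounds. *)
  move: (winS); rewrite white_winE => /existsP[v /andP[vS loseSv]].
  have [aliveS risk_v range_v] := whiteP v vS.
  have := lose_prob_le_move aliveS; rewrite risk_v.
  move: range_v; rewrite (negPf loseSv).
  case: b parS IH whiteP greyP => parS IH whiteP greyP /= range_v le_v;
    last by lra.
  apply/andP; split; last by lra.
  (* Type (1, W): a white move reaches an odd position, where p < 2/3 whoever wins, so its risk
     exceeds 1/3. *)
  apply: lose_prob_gt => [|w _]; first by lra.
  apply: (riskP (fun x => 1 / 3 < x)) => [|u uS|u uS]; first by lra.
    case: (whiteP u uS) => _ ->.
    by case: white_win => /=; lra.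
  by have := grey_half u uS; lra.
have white_move v : v \in white_vertices S ->
    white_win e (delete_closed_nbhd e (white_vertices S) v).
  move=> vS; apply: contraR loseS => loseSv.
  by rewrite white_winE; apply/existsP; exists v; rewrite vS.
case: b parS IH whiteP greyP => parS IH whiteP greyP /=; apply/andP; split=> //.
(* A white move reaches type (1, W), where p <= 1/2. *)
- apply: lose_prob_ge => [|w _]; first by lra.
  apply: (riskP (fun x => 1 / 2 <= x)) => [|u uS|u uS]; first by lra.
    by case: (whiteP u uS) => _ ->; rewrite (white_move u uS) /=; lra.
  exact: grey_half.
- have [noWhite | [v vS]] := set_0Vmem (white_vertices S); last first.
    have [aliveS risk_v] := whiteP v vS.
    rewrite (white_move v vS) => /andP[gt_v _].
    by have := lose_prob_le_move aliveS; rewrite risk_v; lra.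
  have [v Sv | noGrey] := pickP (fun v => is_grey (S v)); last first.
    (* With nothing survivable, the empty play is complete and has no grey choice, against odd
       parity. *)
    suff /parS : complete_lucky_play e S [::] by [].
    apply/forallP=> v; rewrite /survivable noGrey orbF.
    by have := in_set0 v; rewrite -noWhite inE => ->.
  have [aliveS risk_v] := greyP v Sv.
  have -> : delete_closed_nbhd e (white_vertices S) v = set0.
    by apply/setP=> w; rewrite noWhite !inE.
  rewrite /white_win cards0 => /andP[gt_v _].
  by have := lose_prob_le_move aliveS; rewrite risk_v; lra.
(* Type (0, L): white moves reach p < 1/3. Grey moves reach odd parity with p < 2/3, exactly what 1
   - p/2 > 2/3 needs. *)
- apply: lose_prob_gt => [|w _]; first by lra.
  apply: (riskP (fun x => 2 / 3 < x)) => [|u uS|u uS]; first by lra.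
    by case: (whiteP u uS) => _ ->; rewrite (white_move u uS) /=; lra.
  by case: (greyP u uS) => _ ->; case: white_win => /=; lra.
Qed.

End LosingProbability.

(** The neighbours split into predecessors [A] and successors [B], at most one of each. *)
Lemma chain_degree_le2 n (u : 'I_n) : (#|[set v | chain_adj v u]| <= 2)%N.
Proof.
pose A := [set v : 'I_n | v.+1 == u :> nat].
pose B := [set v : 'I_n | u.+1 == v :> nat].
have -> : [set v | chain_adj v u] = A :|: B by apply/setP=> v; rewrite !inE.
have cardA : (#|A| <= 1)%N.
  by apply/card_le1_eqP=> v w; rewrite !inE => /eqP Dv /eqP Dw; apply: ord_inj; lia.
have cardB : (#|B| <= 1)%N.
  by apply/card_le1_eqP=> v w; rewrite !inE => /eqP Dv /eqP Dw; apply: ord_inj; lia.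
by rewrite cardsU; lia.
Qed.

Theorem mainTheorem1 (R : realFieldType) (n : nat) (S : position 'I_n) :
  (1 <= n)%N ->
  reachable (@chain_adj n) (white_chain n) S ->
  [/\ has_type (@chain_adj n) S (0%N, W) ->
        0 <= lose_prob R (@chain_adj n) S < 1 / 3,
      has_type (@chain_adj n) S (1%N, W) ->
        1 / 3 < lose_prob R (@chain_adj n) S <= 1 / 2,
      has_type (@chain_adj n) S (0%N, L) ->
        2 / 3 < lose_prob R (@chain_adj n) S <= 1
    & has_type (@chain_adj n) S (1%N, L) ->
        1 / 2 <= lose_prob R (@chain_adj n) S < 2 / 3].
Proof.
move=> _ reachS.
have rangeS (b : bool) (par : forall s, complete_lucky_play (@chain_adj n) S s ->
    (grey_choices (@chain_adj n) S s %% 2)%N = b) :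
    type_range b (white_win (@chain_adj n) (white_vertices S))
      (lose_prob R (@chain_adj n) S).
  apply: lose_prob_type_range => // [u | s /par]; first exact: chain_degree_le2.
  by rewrite modn2; case: odd; case: b {par}.
by split=> -[/= par win]; [have := rangeS false par | have := rangeS true par
  | have := rangeS false par | have := rangeS true par];
  move: win => /white_winP; case: white_win.
Qed.
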